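(* Let $U=\{1,\dots,n\}$ with distance function $d$, and suppose $p_i=p$ for all $i\in U$, where $0<p<1$. Let $\tau$ be an integer with $2\le\tau\le n$. Then the B$\tau$I (best-$\tau$ items) algorithm is a $(1-p^{\tau-1}-p^{n-\tau}+p^n)$-approximation for MaxOHP. That is, if $O$ is any ordering output by the algorithm, then $$\mathcal{H}(O)\ \ge\ \big(1-p^{\tau-1}-p^{n-\tau}+p^n\big)\,\max_{O'}\mathcal{H}(O'),$$ where the maximum is over all orderings $O'$ of $U$.
   Context: The distance function $d:U\times U\to\mathbb{R}_{\ge0}$ is symmetric with $d(i,i)=0$. For an ordering $O=(\pi(1),\dots,\pi(n))$ of $U$ given by a permutation $\pi$, let $O_k=(\pi(1),\dots,\pi(k))$ and $p_{O_k}=\prod_{t=1}^kp_{\pi(t)}$. The ordered Hamiltonian path objective is $\mathcal{H}(O)=\sum_{i=1}^{n-1}W_{O_i}\,d(\pi(i),\pi(i+1))$ with $W_{O_i}=\sum_{j=i+1}^np_{O_j}$ (so $W_{O_i}=\sum_{j=i+1}^np^j$ when all $p_i=p$). MaxOHP asks for an ordering of $U$ maximizing $\mathcal{H}$. The B$\tau$I algorithm (uniform case) chooses a sequence of $\tau$ distinct items $(\pi(1),\dots,\pi(\tau))$ maximizing $\hat{\mathcal{H}}(O_\tau)=\sum_{i=1}^{\tau-1}\frac{p^{i+1}}{1-p}d(\pi(i),\pi(i+1))$ over all sequences of $\tau$ distinct items of $U$, and then extends it to an ordering of all of $U$ by appending the remaining items in an arbitrary order. *)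

(* Defs.v *)
From HB Require Import structures.
From mathcomp Require Import all_boot all_order all_algebra all_fingroup.
From mathcomp Require Import reals.

Set Implicit Arguments.
Unset Strict Implicit.
Unset Printing Implicit Defensive.

Import Order.TTheory GRing.Theory Num.Theory.
Local Open Scope ring_scope.

(* The n items are the elements of 'I_n and an ordering of them is a
   permutation O : 'S_n, where O i is the item at position i.  Positions are
   numbered from 0, so the i-th item of the mathematical text, counted from 1,
   is the one at position i - 1.  Prefix lengths (k below) are not shifted:
   the prefix O_k consists of the positions 0, ..., k - 1. *)

Definition is_distance (R : realType) (n : nat) (d : 'I_n -> 'I_n -> R) : Prop :=
  [/\ forall i j, 0 <= d i j, forall i j, d i j = d j i & forall i, d i i = 0].

Definition prefix_prob (R : realType) (n : nat) (pr : 'I_n -> R) (O : 'S_n)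
    (k : nat) : R :=
  \prod_(t < n | (t < k)%N) pr (O t).

Definition prefix_weight (R : realType) (n : nat) (pr : 'I_n -> R) (O : 'S_n)
    (k : nat) : R :=
  \sum_(k.+1 <= j < n.+1) prefix_prob pr O j.

(* The inner sum has a single term j = i + 1, and none when i is the last
   position; the edge from position i to i + 1 leaves the prefix O_(i+1). *)
Definition ohp (R : realType) (n : nat) (d : 'I_n -> 'I_n -> R)
    (pr : 'I_n -> R) (O : 'S_n) : R :=
  \sum_(i < n) \sum_(j < n | j == i.+1 :> nat)
     prefix_weight pr O i.+1 * d (O i) (O j).

(* The default value of the iterated maximum is itself one of the values
   over which the maximum ranges. *)
Definition max_ohp (R : realType) (n : nat) (d : 'I_n -> 'I_n -> R)
    (pr : 'I_n -> R) : R :=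
  \big[Num.max/ohp d pr 1%g]_(O : 'S_n) ohp d pr O.

(* The exponent is (i + 1) + 1, since positions are numbered from 0. *)
Definition ohp_hat (R : realType) (n tau : nat) (d : 'I_n -> 'I_n -> R)
    (p : R) (s : {ffun 'I_tau -> 'I_n}) : R :=
  \sum_(i < tau) \sum_(j < tau | j == i.+1 :> nat)
     p ^+ i.+2 / (1 - p) * d (s i) (s j).

(* Relational, because both the choice among the optimal sequences s and the
   order of the appended items are arbitrary. *)
Definition best_items_output (R : realType) (n tau : nat)
    (d : 'I_n -> 'I_n -> R) (p : R) (O : 'S_n) : Prop :=
  exists s : {ffun 'I_tau -> 'I_n},
    [/\ injective s,
        forall s' : {ffun 'I_tau -> 'I_n},
          injective s' -> ohp_hat d p s' <= ohp_hat d p s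
      & forall (i : 'I_tau) (k : 'I_n), k = i :> nat -> O k = s i].

(* Main.v *)
(** Write w_i = p^(i+1)/(1-p) for the weight of the i-th edge in the truncated
    objective, and M for the maximum of that objective over sequences of tau
    distinct items.  In the true objective this weight is
    w_i (1 - p^(n-i)), which is at most w_i and, on the first tau - 1 edges,
    at least w_i (1 - p^(n-tau+1)); so the output is worth at least
    (1 - p^(n-tau+1)) M.  Conversely, cut the edges of an arbitrary ordering
    into blocks of tau - 1 edges.  Reading the ordering cyclically, every block
    visits tau distinct items, hence the k-th block is worth at most
    p^(k(tau-1)) M, and the whole ordering at most M / (1 - p^(tau-1)).  The
    ratio is (1 - p^(tau-1)) (1 - p^(n-tau+1)), which dominates the claimed
    one. *)

Require Import Defs.
From HB Require Import structures.
From mathcomp Require Import all_boot all_order all_algebra all_fingroup.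
From mathcomp Require Import reals.
From mathcomp Require Import ring lra.

Set Implicit Arguments.
Unset Strict Implicit.
Unset Printing Implicit Defensive.

Import Order.TTheory GRing.Theory Num.Theory.
Local Open Scope ring_scope.

(** Both objectives have this shape. Indexing by naturals through [inZp] lets edges be shifted past
    the last position without bound proofs. *)
Lemma sum_consecutive (V : nmodType) (m : nat)
    (F : 'I_m.+1 -> 'I_m.+1 -> V) :
  \sum_(i < m.+1) \sum_(j < m.+1 | j == i.+1 :> nat) F i j =
  \sum_(i < m) F (inZp i) (inZp i.+1).
Proof.
rewrite big_ord_recr /= [X in _ + X]big1 ?addr0; last first.
  by move=> j /eqP jE; have := ltn_ord j; rewrite jE ltnn.
apply: eq_bigr => i _.
have inZpE k : (k < m.+1)%N -> (inZp k : 'I_m.+1) = k :> nat by move=> /modn_small.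
rewrite (big_pred1 (inZp i.+1)) => [|j]; last first.
  by rewrite -[RHS](inj_eq val_inj) [X in _ = (_ == X)]inZpE // ltnS ltn_ord.
congr F; apply: val_inj; rewrite [RHS]inZpE //.
exact: ltnW (ltn_ord i).
Qed.

(** Induction on the number of blocks: past the first block, what remains is [p ^+ m] times the same
    kind of sum started at [s + m], and [(1 - p ^+ m) * M + p ^+ m * M = M]. Hence the start [s]
    must vary in the induction. *)
Lemma sum_geometric_blocks (R : realFieldType) (p M : R) (m : nat)
    (e : nat -> R) :
  0 <= p -> p ^+ m <= 1 -> 0 <= M ->
  (forall s, \sum_(t < m) p ^+ t * e (s + t)%N <= M) ->
  forall K s, (1 - p ^+ m) * \sum_(i < K * m) p ^+ i * e (s + i)%N <= M.
Proof.
move=> p_ge0 pm_le1 M_ge0 eM; elim=> [|K IH] s.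
  by rewrite big_ord0 mulr0.
rewrite mulSn big_split_ord /=.
under [X in _ * (_ + X)]eq_bigr => i _ do rewrite exprD -mulrA addnA.
rewrite -mulr_sumr mulrDr mulrCA.
have leM := ler_wpM2l (exprn_ge0 m p_ge0) (IH (s + m)%N).
have le1 : (1 - p ^+ m) * \sum_(t < m) p ^+ t * e (s + t)%N <= (1 - p ^+ m) * M.
  by apply: ler_wpM2l (eM s); rewrite subr_ge0.
by apply: le_trans (lerD le1 leM) _; rewrite -mulrDl subrK mul1r.
Qed.

Section UniformProbability.

Variables (R : realType) (n : nat) (d : 'I_n.+1 -> 'I_n.+1 -> R) (p : R).
Hypotheses (d_dist : is_distance d) (p_gt0 : 0 < p) (p_lt1 : p < 1).

Lemma prefix_prob_unif (pr : 'I_n.+1 -> R) (O : 'S_n.+1) (k : nat) :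
  (forall i, pr i = p) -> (k <= n.+1)%N -> prefix_prob pr O k = p ^+ k.
Proof.
move=> prE kn; rewrite /prefix_prob (eq_bigr (fun=> p)) //.
by rewrite -(big_ord_widen n.+1 (fun=> p) kn) prodr_const card_ord.
Qed.

(** The geometric sum telescopes once multiplied by [1 - p]. The factor [p ^+ 2 / (1 - p)] is kept
    apart for [cyclic_edge] to absorb, leaving the pure power [p ^+ k]. *)
Lemma prefix_weight_unif (pr : 'I_n.+1 -> R) (O : 'S_n.+1) (k : nat) :
  (forall i, pr i = p) -> (k <= n)%N ->
  prefix_weight pr O k.+1 = p ^+ k * (1 - p ^+ (n - k)) * (p ^+ 2 / (1 - p)).
Proof.
move=> prE kn; rewrite /prefix_weight.
rewrite (eq_big_nat _ _ (F2 := fun j => p ^+ j)); last first.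
  by move=> j /andP[_ jn]; exact: prefix_prob_unif.
have p1 : 1 - p != 0 by rewrite gt_eqF // subr_gt0.
apply: (mulfI p1).
rewrite [LHS]mulrC.
have -> : (\sum_(k.+2 <= j < n.+2) p ^+ j) * (1 - p) = p ^+ k.+2 - p ^+ n.+2.
  rewrite mulr_suml -[RHS]opprB -telescope_sumr ?ltnS // -sumrN.
  by apply: eq_bigr => j _; rewrite mulrBr mulr1 -exprSr opprB.
have -> : p ^+ n.+2 = p ^+ (n - k) * p ^+ k.+2 by rewrite -exprD !addnS subnK.
rewrite -addn2 exprD; move: (p ^+ (n - k)) (p ^+ k) => a b.
by field.
Qed.

(* Cyclic: position i is read modulo the number of items. *)
Definition cyclic_edge (O : 'S_n.+1) (i : nat) : R :=
  p ^+ 2 / (1 - p) * d (O (inZp i)) (O (inZp i.+1)).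

Lemma cyclic_edge_ge0 O i : 0 <= cyclic_edge O i.
Proof.
case: d_dist => d_ge0 _ _.
by rewrite mulr_ge0 // divr_ge0 // ?exprn_ge0 ?subr_ge0 // ltW.
Qed.

Lemma ohp_unif (pr : 'I_n.+1 -> R) (O : 'S_n.+1) :
  (forall i, pr i = p) ->
  ohp d pr O = \sum_(i < n) (1 - p ^+ (n - i)) * (p ^+ i * cyclic_edge O i).
Proof.
move=> prE; rewrite /ohp sum_consecutive; apply: eq_bigr => i _.
have iE : (inZp i : 'I_n.+1) = i :> nat by rewrite /= modn_small // ltnW // ltnS.
rewrite iE prefix_weight_unif // 1?ltnW // /cyclic_edge.
by rewrite !mulrA [_ * (1 - _)]mulrC.
Qed.

(** Exponents count from the start of the window, not of the ordering, as [sum_geometric_blocks]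
    requires of its blocks. *)
Lemma ohp_hatE (m : nat) (s : {ffun 'I_m.+1 -> 'I_n.+1}) (O : 'S_n.+1)
    (k : nat) :
  (forall t : 'I_m.+1, s t = O (inZp (k + t))) ->
  ohp_hat d p s = \sum_(t < m) p ^+ t * cyclic_edge O (k + t).
Proof.
move=> sE; rewrite /ohp_hat.
rewrite (sum_consecutive
  (fun i j : 'I_m.+1 => p ^+ i.+2 / (1 - p) * d (s i) (s j))).
apply: eq_bigr => t _; rewrite !sE /= !modn_small ?ltnS ?(ltnW (ltn_ord t)) //.
by rewrite /cyclic_edge addnS -addn2 exprD !mulrA.
Qed.

Lemma cyclic_window_inj (m : nat) (O : 'S_n.+1) (k : nat) :
  (m <= n)%N -> injective [ffun t : 'I_m.+1 => O (inZp (k + t))].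
Proof.
move=> mn t u; rewrite !ffunE => /perm_inj /(congr1 val) /= /eqP.
rewrite eqn_modDl => /eqP.
by rewrite !modn_small ?(leq_trans (ltn_ord _)) // => /val_inj.
Qed.

Lemma ohp_hat_ge0 (m : nat) (s : {ffun 'I_m -> 'I_n.+1}) : 0 <= ohp_hat d p s.
Proof.
case: d_dist => d_ge0 _ _; do 2!apply: sumr_ge0 => ? _.
by rewrite mulr_ge0 // divr_ge0 // ?exprn_ge0 ?subr_ge0 // ltW.
Qed.

Lemma ohp_ge0 (pr : 'I_n.+1 -> R) (O : 'S_n.+1) :
  (forall i, pr i = p) -> 0 <= ohp d pr O.
Proof.
move=> prE; have p_ge0 := ltW p_gt0; have p_le1 := ltW p_lt1.
rewrite ohp_unif //; apply: sumr_ge0 => i _.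
apply: mulr_ge0; first by rewrite subr_ge0 exprn_ile1.
by rewrite mulr_ge0 ?exprn_ge0 ?cyclic_edge_ge0.
Qed.

Lemma ohp_le_ohp_hat (m : nat) (s : {ffun 'I_m.+2 -> 'I_n.+1})
    (pr : 'I_n.+1 -> R) (O : 'S_n.+1) :
  (forall i, pr i = p) -> (m.+1 <= n)%N ->
  (forall s' : {ffun 'I_m.+2 -> 'I_n.+1},
    injective s' -> ohp_hat d p s' <= ohp_hat d p s) ->
  (1 - p ^+ m.+1) * ohp d pr O <= ohp_hat d p s.
Proof.
move=> prE mn s_max.
have p_ge0 := ltW p_gt0; have p_le1 := ltW p_lt1.
have pX_le1 k : p ^+ k <= 1 by rewrite exprn_ile1.
(* Taking [n] blocks, more than enough to cover the [n] edges, avoids rounding a quotient up; the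
   surplus cyclic edges only add nonnegative terms. *)
have n_le : (n <= n * m.+1)%N by rewrite leq_pmulr.
have := @sum_geometric_blocks _ _ _ _ _ p_ge0 (pX_le1 m.+1) (ohp_hat_ge0 s).
move=> /(_ (cyclic_edge O)) blocks.
have {}blocks := blocks _ n 0%N.
apply: le_trans (blocks _); last first.
  move=> k; pose s' := [ffun t : 'I_m.+2 => O (inZp (k + t))].
  rewrite -(@ohp_hatE _ s') => [|t]; last by rewrite ffunE.
  exact/s_max/cyclic_window_inj.
apply: ler_wpM2l; first by rewrite subr_ge0.
rewrite ohp_unif //.
have term_ge0 i : 0 <= p ^+ i * cyclic_edge O i.
  by rewrite mulr_ge0 ?exprn_ge0 ?cyclic_edge_ge0.
apply: (@le_trans _ _ (\sum_(i < n) p ^+ i * cyclic_edge O i)).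
  by apply: ler_sum => i _; rewrite ler_piMl // gerBl exprn_ge0.
rewrite (big_ord_widen _ (fun i => p ^+ i * cyclic_edge O i) n_le) big_mkcond.
by apply: ler_sum => i _; case: ifP.
Qed.

Lemma ohp_hat_le_ohp (m : nat) (s : {ffun 'I_m.+1 -> 'I_n.+1})
    (pr : 'I_n.+1 -> R) (O : 'S_n.+1) :
  (forall i, pr i = p) -> (m <= n)%N ->
  (forall (i : 'I_m.+1) (k : 'I_n.+1), k = i :> nat -> O k = s i) ->
  (1 - p ^+ (n.+1 - m)) * ohp_hat d p s <= ohp d pr O.
Proof.
move=> prE mn Os.
have p_ge0 := ltW p_gt0; have p_le1 := ltW p_lt1.
have term_ge0 i : 0 <= p ^+ i * cyclic_edge O i.
  by rewrite mulr_ge0 ?exprn_ge0 ?cyclic_edge_ge0.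
rewrite (@ohp_hatE _ _ O 0) => [|t]; last first.
  by apply/esym/Os; rewrite /= modn_small // (leq_trans (ltn_ord t)).
rewrite ohp_unif // mulr_sumr.
rewrite (big_ord_widen _ (fun t => (1 - p ^+ (n.+1 - m)) *
  (p ^+ t * cyclic_edge O (0 + t))) mn) big_mkcond.
apply: ler_sum => i _; rewrite add0n; case: ifP => im.
  apply: ler_wpM2r => //; rewrite lerD2l lerN2.
  (* Since [i < m], the exponent [n - i] is at least [n.+1 - m], with equality at the last edge of
     the chosen sequence. *)
  apply: ler_wiXn2l => //.
  by rewrite leq_subCl subnA ?(ltnW (ltn_ord i)) // ?leqW // subSnn.
by rewrite mulr_ge0 // subr_ge0 exprn_ile1.
Qed.

End UniformProbability.

Theorem theorem6p1 (R : realType) (n tau : nat) (d : 'I_n -> 'I_n -> R)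
    (pr : 'I_n -> R) (p : R) (O : 'S_n)
    (d_dist : is_distance d)
    (p_gt0 : 0 < p) (p_lt1 : p < 1)
    (pr_unif : forall i : 'I_n, pr i = p)
    (tau_ge2 : (2 <= tau)%N) (tau_le_n : (tau <= n)%N)
    (O_out : best_items_output tau d p O) :
  (1 - p ^+ (tau - 1) - p ^+ (n - tau) + p ^+ n) * max_ohp d pr <= ohp d pr O.
Proof.
case: O_out => s [_ s_max Os].
case: tau tau_ge2 tau_le_n s s_max Os => [|[|m]] // _.
case: n d pr O d_dist pr_unif => [|n'] // d' pr' O' dd prE mn s s_max Os.
have p_ge0 := ltW p_gt0; have p_le1 := ltW p_lt1.
have max_le : (1 - p ^+ m.+1) * max_ohp d' pr' <= ohp_hat d' p s.
  rewrite /max_ohp; elim/big_ind: _ => [|x y xM yM|Q _].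
  (* The default value is the objective of the identity ordering, so the same bound covers it. *)
  - exact: ohp_le_ohp_hat.
  - by rewrite maxEle; case: ifP.
  - exact: ohp_le_ohp_hat.
have max_ge0 : 0 <= max_ohp d' pr'.
  exact: le_trans (ohp_ge0 dd p_gt0 p_lt1 1%g prE) (bigmax_ge_id _ _ _ _).
apply: le_trans (ohp_hat_le_ohp dd p_gt0 p_lt1 prE (mn : (m < n')%N) Os).
apply: le_trans (ler_wpM2l _ max_le); last by rewrite subr_ge0 exprn_ile1.
rewrite mulrA; apply: ler_wpM2r => //.
rewrite subn1 /= !subSS.
(* This makes [p ^+ n] the cross term of [(1 - p ^+ (n - tau + 1)) * (1 - p ^+ (tau - 1))]; [pn]
   then gives up one factor [p] in the remaining term. *)
have nE : n'.+1 = ((n' - m.+1).+1 + m.+1)%N by rewrite addSn subnK.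
have pn : p ^+ (n' - m) <= p ^+ (n' - m.+1) by rewrite ler_wiXn2l // leq_sub2l.
rewrite {1}nE subnSK // exprD.
lra.
Qed.
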